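(* Let $M$ be an $n$-dimensional Riemannian manifold with Riemannian metric $g$ and Levi-Civita connection $\nabla$. Let $f_1,f_2$ be functions on $M$, let $u,u_1,u_2$ be $1$-forms on $M$, and let $\varphi$ be a $(1,1)$ tensor field on $M$. Let $U,U_1,U_2$ be the vector fields defined by $u(X)=g(U,X)$, $u_1(X)=g(U_1,X)$, $u_2(X)=g(U_2,X)$ for all vector fields $X$. Let $\Phi(X,Y)=g(\varphi X,Y)$, let $\Phi=\Phi_1+\Phi_2$ be its decomposition into its symmetric part $\Phi_1$ and its skew-symmetric part $\Phi_2$, and let $\varphi_1,\varphi_2$ be the $(1,1)$ tensor fields defined by $\Phi_1(X,Y)=g(\varphi_1X,Y)$ and $\Phi_2(X,Y)=g(\varphi_2X,Y)$. Then there exists a unique linear connection $\tilde\nabla$ on $M$ which satisfies, for all vector fields $X,Y,Z$, $$\tilde T(X,Y)=u(Y)\varphi X-u(X)\varphi Y$$ and $$(\tilde\nabla_Xg)(Y,Z)=2f_1u_1(X)g(Y,Z)+f_2\{u_2(Y)g(X,Z)+u_2(Z)g(X,Y)\},$$ where $\tilde T$ is the torsion tensor of $\tilde\nabla$; and this connection is given by $$\tilde\nabla_XY=\nabla_XY+u(Y)\varphi_1X-u(X)\varphi_2Y-g(\varphi_1X,Y)U-f_1\{u_1(X)Y+u_1(Y)X-g(X,Y)U_1\}-f_2\,g(X,Y)U_2.$$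
   Context: All functions, vector fields, $1$-forms and tensor fields are smooth. The torsion tensor of a linear connection $\tilde\nabla$ on $M$ is $\tilde T(X,Y)=\tilde\nabla_XY-\tilde\nabla_YX-[X,Y]$. The covariant derivative of the metric is $(\tilde\nabla_Xg)(Y,Z)=X(g(Y,Z))-g(\tilde\nabla_XY,Z)-g(Y,\tilde\nabla_XZ)$. *)

(* Defs.v *)
From HB Require Import structures.
From mathcomp Require Import all_boot all_order all_algebra.
From mathcomp Require Import all_classical all_reals all_analysis.
From mathcomp Require Import ring.

Set Implicit Arguments.
Unset Strict Implicit.
Unset Printing Implicit Defensive.

Import Order.TTheory GRing.Theory Num.Theory.
Import numFieldNormedType.Exports.

Local Open Scope classical_set_scope.
Local Open Scope ring_scope.

#[local] Obligation Tactic := idtac.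

(* [Ck_on k U f]: on the open set U, all iterated partial derivatives of f of
   order at most k exist and are continuous. *)
Fixpoint Ck_on (R : realType) (n : nat) (W : normedModType R) (k : nat)
    (U : set 'rV[R]_n) (f : 'rV[R]_n -> W) : Prop :=
  (forall x, U x -> {for x, continuous f}) /\
  match k with
  | 0%N => True
  | k'.+1 => forall i : 'I_n,
      (forall x, U x -> derivable f x (delta_mx 0 i)) /\
      Ck_on k' U (fun x => 'D_(delta_mx 0 i) f x)
  end.

Definition smooth_on (R : realType) (n : nat) (W : normedModType R)
    (U : set 'rV[R]_n) (f : 'rV[R]_n -> W) : Prop :=
  forall k, Ck_on k U f.

Section SmoothOn.
Variables (R : realType) (n : nat) (U : set 'rV[R]_n).
Hypothesis oU : open U.

Lemma Ck_on_cont (W : normedModType R) k (f : 'rV[R]_n -> W) :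
  Ck_on k U f -> forall x, U x -> {for x, continuous f}.
Proof. by case: k => [|k] []. Qed.

Lemma Ck_onW (W : normedModType R) k (f : 'rV[R]_n -> W) :
  Ck_on k.+1 U f -> Ck_on k U f.
Proof.
elim: k f => [|k IHk] f [cf df]; split=> // i.
by have [? ?] := df i; split=> //; exact: IHk.
Qed.

Lemma Ck_on_ext (W : normedModType R) k (f g : 'rV[R]_n -> W) :
  (forall x, U x -> f x = g x) -> Ck_on k U f -> Ck_on k U g.
Proof.
have nearU (h1 h2 : 'rV[R]_n -> W) x : (forall x, U x -> h1 x = h2 x) ->
    U x -> \forall y \near x, h1 y = h2 y.
  by move=> e Ux; apply: filterS (open_nbhs_nbhs (conj oU Ux)) => y /e.
have cext (h1 h2 : 'rV[R]_n -> W) : (forall x, U x -> h1 x = h2 x) ->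
    (forall x, U x -> {for x, continuous h1}) ->
    forall x, U x -> {for x, continuous h2}.
  move=> e c x Ux; have cx : h1 @ x --> h1 x := c x Ux.
  rewrite (e _ Ux) in cx.
  by apply: cvg_trans cx; apply: (near_eq_cvg (F := nbhs x)); exact: nearU.
elim: k f g => [|k IHk] f g fg [cf df]; split=> //; try exact: cext fg cf.
move=> i; have [dfi Cfi] := df i; split=> [x Ux|].
  by apply: near_eq_derivable (dfi _ Ux); exact: nearU.
by apply: IHk Cfi => x Ux; apply: near_eq_derive; exact: nearU.
Qed.

Lemma Ck_on_cst (W : normedModType R) k (c : W) : Ck_on k U (fun=> c).
Proof.
elim: k c => [|k IHk] c; split=> //;
  try by move=> x _; exact: cst_continuous.
move=> i; split=> [x _|]; first exact: derivable_cst.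
by apply: (Ck_on_ext _ (IHk 0)) => x _; rewrite derive_cst.
Qed.

Lemma Ck_onD (W : normedModType R) k (f g : 'rV[R]_n -> W) :
  Ck_on k U f -> Ck_on k U g -> Ck_on k U (f + g).
Proof.
elim: k f g => [|k IHk] f g [cf df] [cg dg]; split=> //;
  try by move=> x Ux; exact: (continuousD (cf x Ux) (cg x Ux)).
move=> i; have [dfi Cfi] := df i; have [dgi Cgi] := dg i.
split=> [x Ux|]; first by apply: derivableD; [exact: dfi|exact: dgi].
apply: Ck_on_ext (IHk _ _ Cfi Cgi) => x Ux.
by rewrite deriveD//; [exact: dfi|exact: dgi].
Qed.

Lemma Ck_onM k (f g : 'rV[R]_n -> R) :
  Ck_on k U f -> Ck_on k U g -> Ck_on k U (f * g).
Proof.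
elim: k f g => [|k IHk] f g Cf Cg; move: (Cf) (Cg) => [cf df] [cg dg];
  split=> //; try by move=> x Ux; exact: (continuousM (cf x Ux) (cg x Ux)).
move=> i; have [dfi Cfi] := df i; have [dgi Cgi] := dg i.
split=> [x Ux|]; first by apply: derivableM; [exact: dfi|exact: dgi].
have Cfg := Ck_onD (IHk _ _ (Ck_onW Cf) Cgi) (IHk _ _ (Ck_onW Cg) Cfi).
apply: Ck_on_ext Cfg => x Ux.
by rewrite deriveM//; [exact: dfi|exact: dgi].
Qed.

End SmoothOn.

Section Manifold.
Variables (R : realType) (n : nat).

(* The values of [chart_map] outside [chart_dom] and of [chart_inv] outside
   [chart_img] are irrelevant. *)
Record chart (T : topologicalType) := Chart {
  chart_dom : set T;
  chart_img : set 'rV[R]_n;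
  chart_map : T -> 'rV[R]_n;
  chart_inv : 'rV[R]_n -> T;
  chart_dom_open : open chart_dom;
  chart_img_open : open chart_img;
  chart_map_img : forall p, chart_dom p -> chart_img (chart_map p);
  chart_inv_dom : forall x, chart_img x -> chart_dom (chart_inv x);
  chart_mapK : forall p, chart_dom p -> chart_inv (chart_map p) = p;
  chart_invK : forall x, chart_img x -> chart_map (chart_inv x) = x;
  chart_map_cont : forall p, chart_dom p -> {for p, continuous chart_map};
  chart_inv_cont : forall x, chart_img x -> {for x, continuous chart_inv} }.

Arguments chart_dom_open {T} c.
Arguments chart_img_open {T} c.

(* The smooth structure is given by a smooth atlas, not necessarily maximal. *)
Record manifold := Manifold {
  carrier :> topologicalType;
  atlas : set (chart carrier);
  manifold_hausdorff : hausdorff_space carrier;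
  manifold_countable : @second_countable carrier;
  atlas_cover : forall p : carrier, exists2 c, atlas c & chart_dom c p;
  atlas_compat : forall c d, atlas c -> atlas d ->
    smooth_on [set x | chart_img c x /\ chart_dom d (chart_inv c x)]
              (chart_map d \o chart_inv c) }.

Definition smooth (M : manifold) (f : M -> R) : Prop :=
  forall c, atlas c -> smooth_on (chart_img c) (f \o chart_inv c).

Section SmoothFunctions.
Variable M : manifold.
Implicit Types f h : M -> R.

Lemma smooth_cst (a : R) : smooth (fun _ : M => a).
Proof. by move=> c _ k; exact: (Ck_on_cst (chart_img_open c)). Qed.

Lemma smoothD f h : smooth f -> smooth h -> smooth (fun p => f p + h p).
Proof.
move=> sf sh c Ac k.
by apply: (Ck_onD (chart_img_open c) (sf c Ac k) (sh c Ac k)).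
Qed.

Lemma smoothM f h : smooth f -> smooth h -> smooth (fun p => f p * h p).
Proof.
move=> sf sh c Ac k.
by apply: (Ck_onM (chart_img_open c) (sf c Ac k) (sh c Ac k)).
Qed.

Lemma smoothN f : smooth f -> smooth (fun p => - f p).
Proof.
move=> sf; have := smoothM (smooth_cst (-1)) sf.
by under [X in smooth X -> _]eq_fun do rewrite mulN1r.
Qed.

Definition smooth_pred : {pred M -> R} := fun f => `[< smooth f >].

(* C^oo(M). As a ring it is only a comPzRingType: M may be empty. *)
Record Cinf := MkCinf {
  Cinf_fun :> M -> R;
  Cinf_smoothP : smooth_pred Cinf_fun }.

HB.instance Definition _ := [isSub of Cinf for Cinf_fun].
HB.instance Definition _ := [Choice of Cinf by <:].

Lemma smooth_subring_closed : subring_closed smooth_pred.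
Proof.
split; first by apply/asboolP; exact: smooth_cst.
- move=> f h /asboolP sf /asboolP sh; apply/asboolP.
  by apply: (smoothD sf); exact: smoothN.
- by move=> f h /asboolP sf /asboolP sh; apply/asboolP; exact: smoothM.
Qed.
HB.instance Definition _ :=
  GRing.isSubringClosed.Build _ smooth_pred smooth_subring_closed.
HB.instance Definition _ := 
  GRing.SubChoice_isSubComPzRing.Build _ _ Cinf (subringClosedP smooth_pred).

Lemma smooth_submod_closed : submod_closed smooth_pred.
Proof.
split; first by apply/asboolP; exact: smooth_cst.
move=> a f h /asboolP sf /asboolP sh; apply/asboolP.
by apply: (smoothD _ sh); exact: (smoothM (smooth_cst a)).
Qed.
HB.instance Definition _ :=
  GRing.isSubmodClosed.Build R _ smooth_pred smooth_submod_closed.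
HB.instance Definition _ := [SubZmodule_isSubLmodule of Cinf by <:].

Lemma Cinf_smooth (f : Cinf) : smooth f.
Proof. exact/asboolP/Cinf_smoothP. Qed.

Definition mkCinf f (sf : smooth f) : Cinf := MkCinf (introT (asboolP _) sf).

Lemma CinfP (f h : Cinf) : (forall p, f p = h p) <-> f = h.
Proof. by split=> [fh|->//]; apply/val_inj/funext. Qed.

End SmoothFunctions.

(* Tangent vectors at p are the derivations at p of C^oo(M). *)
Section Tangent.
Variables (M : manifold) (p : M).

Record tangent := MkTangent {
  tangent_fun :> Cinf M -> R;
  tangent_linear : forall (a : R) (f h : Cinf M),
    tangent_fun (a *: f + h) = a * tangent_fun f + tangent_fun h;
  tangent_leibniz : forall f h : Cinf M,
    tangent_fun (f * h) = f p * tangent_fun h + h p * tangent_fun f }.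

Implicit Types v w : tangent.

Lemma tangentP v w : (forall f, v f = w f) <-> v = w.
Proof.
split=> [|->//]; case: v w => [v lv dv] [w lw dw] /= vw.
have e : v = w by exact/funext.
by move: lv dv; rewrite e => lv dv; congr MkTangent; exact: Prop_irrelevance.
Qed.

Program Definition tangent0 := @MkTangent (fun=> 0) _ _.
Next Obligation. by move=> a f h; rewrite /= mulr0 addr0. Qed.
Next Obligation. by move=> f h; rewrite /= !mulr0 addr0. Qed.

Program Definition tangentD v w := @MkTangent (fun f => v f + w f) _ _.
Next Obligation.
by move=> v w a f h; rewrite /= !tangent_linear mulrDr addrACA.
Qed.
Next Obligation.
by move=> v w f h; rewrite /= !tangent_leibniz !mulrDr addrACA.
Qed.

Program Definition tangentZ (a : R) v := @MkTangent (fun f => a * v f) _ _.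
Next Obligation.
by move=> a v b f h; rewrite /= tangent_linear mulrDr mulrCA.
Qed.
Next Obligation.
move=> a v f h; rewrite /= tangent_leibniz mulrDr.
by rewrite mulrCA [a * (h p * _)]mulrCA.
Qed.

HB.instance Definition _ := gen_eqMixin tangent.
HB.instance Definition _ := gen_choiceMixin tangent.

Program Definition tangent_isZmodule := @GRing.isZmodule.Build tangent
  tangent0 (tangentZ (-1)) tangentD _ _ _ _.
Next Obligation. by move=> u v w; apply/tangentP => f /=; rewrite addrA. Qed.
Next Obligation. by move=> v w; apply/tangentP => f /=; rewrite addrC. Qed.
Next Obligation. by move=> v; apply/tangentP => f /=; rewrite add0r. Qed.
Next Obligation. by move=> v; apply/tangentP => f /=; rewrite mulN1r addNr. Qed.
HB.instance Definition _ := tangent_isZmodule.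

Program Definition tangent_isLmodule :=
  @GRing.Zmodule_isLmodule.Build R tangent tangentZ _ _ _ _.
Next Obligation. by move=> a b v; apply/tangentP => f /=; rewrite mulrA. Qed.
Next Obligation. by move=> v; apply/tangentP => f /=; rewrite mul1r. Qed.
Next Obligation. by move=> a v w; apply/tangentP => f /=; rewrite mulrDr. Qed.
Next Obligation. by move=> v a b; apply/tangentP => f /=; rewrite mulrDl. Qed.
HB.instance Definition _ := tangent_isLmodule.

End Tangent.

(* A vector field X is smooth iff X f is smooth for every smooth f; vector
   fields form a module over C^oo(M). *)
Section VectorFields.
Variable M : manifold.

Definition smooth_field (X : forall p : M, tangent p) : Prop :=
  forall f : Cinf M, smooth (fun p => X p f).

Record vfield := MkVfield {
  vfield_at :> forall p : M, tangent p;
  vfield_smooth : smooth_field vfield_at }.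

Implicit Types X Y : vfield.

Lemma vfieldP X Y : (forall p, X p = Y p) <-> X = Y.
Proof.
split=> [|->//]; case: X Y => [X sX] [Y sY] /= XY.
have e : X = Y by exact: functional_extensionality_dep.
by move: sX; rewrite e => sX; congr MkVfield; exact: Prop_irrelevance.
Qed.

Program Definition vfield0 := @MkVfield (fun=> 0) _.
Next Obligation. by move=> f; exact: smooth_cst. Qed.

Program Definition vfieldD X Y := @MkVfield (fun p => X p + Y p) _.
Next Obligation. by move=> X Y f; apply: smoothD; exact: vfield_smooth. Qed.

Program Definition vfieldZ (h : Cinf M) X := @MkVfield (fun p => h p *: X p) _.
Next Obligation.
by move=> h X f; apply: smoothM; [exact: Cinf_smooth|exact: vfield_smooth].
Qed.

HB.instance Definition _ := gen_eqMixin vfield.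
HB.instance Definition _ := gen_choiceMixin vfield.

Program Definition vfield_isZmodule := @GRing.isZmodule.Build vfield
  vfield0 (vfieldZ (-1)) vfieldD _ _ _ _.
Next Obligation. by move=> X Y Z; apply/vfieldP => p /=; rewrite addrA. Qed.
Next Obligation. by move=> X Y; apply/vfieldP => p /=; rewrite addrC. Qed.
Next Obligation. by move=> X; apply/vfieldP => p /=; rewrite add0r. Qed.
Next Obligation.
by move=> X; apply/vfieldP => p /=; rewrite scaleN1r addNr.
Qed.
HB.instance Definition _ := vfield_isZmodule.

Program Definition vfield_isLmodule :=
  @GRing.Zmodule_isLmodule.Build (Cinf M) vfield vfieldZ _ _ _ _.
Next Obligation. by move=> a b X; apply/vfieldP => p /=; rewrite scalerA. Qed.
Next Obligation. by move=> X; apply/vfieldP => p /=; rewrite scale1r. Qed.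
Next Obligation. by move=> a X Y; apply/vfieldP => p /=; rewrite scalerDr. Qed.
Next Obligation. by move=> X a b; apply/vfieldP => p /=; rewrite scalerDl. Qed.
HB.instance Definition _ := vfield_isLmodule.

(* X f *)
Definition vder X (f : Cinf M) : Cinf M := mkCinf (vfield_smooth X f).

Lemma vder_linear X (a : R) (f h : Cinf M) :
  vder X (a *: f + h) = a *: vder X f + vder X h.
Proof. by apply/CinfP => p; exact: tangent_linear. Qed.

Lemma vder_leibniz X (f h : Cinf M) :
  vder X (f * h) = f * vder X h + h * vder X f.
Proof. by apply/CinfP => p; exact: tangent_leibniz. Qed.

Program Definition lie_at X Y (p : M) : tangent p :=
  @MkTangent M p (fun f => X p (vder Y f) - Y p (vder X f)) _ _.
Next Obligation.
move=> X Y p a f h; rewrite /= !vder_linear !tangent_linear.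
by rewrite mulrBr opprD addrACA.
Qed.
Next Obligation.
move=> X Y p f h.
have tD (Z : vfield) (a b : Cinf M) : Z p (a + b) = Z p a + Z p b.
  by have := tangent_linear (Z p) 1 a b; rewrite scale1r mul1r.
by rewrite !vder_leibniz !tD !tangent_leibniz /=; ring.
Qed.

Program Definition lie X Y : vfield := @MkVfield (lie_at X Y) _.
Next Obligation.
move=> X Y f /=; apply: smoothD; first exact: vfield_smooth.
by apply: smoothN; exact: vfield_smooth.
Qed.

End VectorFields.

(* Tensor fields are families of (multi)linear maps on the tangent spaces; they
   are smooth iff their values on smooth vector fields are smooth. *)
Section Tensors.
Variable M : manifold.

Record form1 := MkForm1 {
  form1_at : forall p : M, {scalar tangent p};
  form1_smooth : forall X : vfield M, smooth (fun p => form1_at p (X p)) }.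

Definition form1_ev (u : form1) (X : vfield M) : Cinf M :=
  mkCinf (form1_smooth u X).

Record tensor11 := MkTensor11 {
  tensor11_at : forall p : M, {linear tangent p -> tangent p};
  tensor11_smooth : forall X : vfield M,
    smooth_field (fun p => tensor11_at p (X p)) }.

Definition tensor11_ev (phi : tensor11) (X : vfield M) : vfield M :=
  MkVfield (tensor11_smooth phi X).

Record tensor02 := MkTensor02 {
  tensor02_at : forall p : M, {biscalar tangent p};
  tensor02_smooth : forall X Y : vfield M,
    smooth (fun p => tensor02_at p (X p) (Y p)) }.

Definition tensor02_ev (t : tensor02) (X Y : vfield M) : Cinf M :=
  mkCinf (tensor02_smooth t X Y).

Record riemannian_metric := MkMetric {
  metric_tensor : tensor02;
  metric_sym : forall (p : M) (v w : tangent p),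
    tensor02_at metric_tensor p v w = tensor02_at metric_tensor p w v;
  metric_pos : forall (p : M) (v : tangent p),
    v != 0 -> 0 < tensor02_at metric_tensor p v v }.

(* Additivity and the Leibniz rule for constant f give R-linearity in the
   second argument. *)
Record connection := MkConnection {
  nabla : vfield M -> vfield M -> vfield M;
  nabla_linearl : forall (f : Cinf M) (X X' Y : vfield M),
    nabla (f *: X + X') Y = f *: nabla X Y + nabla X' Y;
  nabla_additiver : forall X Y Y' : vfield M,
    nabla X (Y + Y') = nabla X Y + nabla X Y';
  nabla_leibniz : forall (X : vfield M) (f : Cinf M) (Y : vfield M),
    nabla X (f *: Y) = f *: nabla X Y + vder X f *: Y }.

End Tensors.

End Manifold.

Coercion form1_ev : form1 >-> Funclass.
Coercion tensor11_ev : tensor11 >-> Funclass.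
Coercion tensor02_ev : tensor02 >-> Funclass.
Coercion metric_tensor : riemannian_metric >-> tensor02.
Coercion nabla : connection >-> Funclass.

Section Connections.
Variables (R : realType) (n : nat) (M : manifold R n).

Definition torsion (D : connection M) (X Y : vfield M) : vfield M :=
  D X Y - D Y X - lie X Y.

Definition nabla_metric (D : connection M) (g : riemannian_metric M)
    (X Y Z : vfield M) : Cinf M :=
  vder X (g Y Z) - g (D X Y) Z - g Y (D X Z).

Definition levi_civita (g : riemannian_metric M) (D : connection M) : Prop :=
  (forall X Y, torsion D X Y = 0) /\ (forall X Y Z, nabla_metric D g X Y Z = 0).

End Connections.

(* Main.v *)
Require Import Defs.
From HB Require Import structures.
From mathcomp Require Import all_boot all_order all_algebra.
From mathcomp Require Import all_classical all_reals all_analysis.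
From mathcomp Require Import ring.

(** The connections on M form an affine space over the C^oo(M)-bilinear maps
    H : vfield M -> vfield M -> vfield M.  Replacing D by D + H changes the
    torsion by H X Y - H Y X ([torsion_shift]) and changes the derivative of g
    by - g (H X Y) Z - g Y (H X Z) ([nabla_metric_shift]).

    Existence.  Take for D the Levi-Civita connection, so that both quantities
    start from zero, and for H the difference between the right-hand side of
    the stated formula and D ([deformation]).  Write Phi1 and Phi2 for the
    symmetric and skew parts of Phi.  In H X Y - H Y X the terms along U, U1
    and U2, and the f1 terms in X and Y, are symmetric in X and Y and cancel;
    what remains is u Y *: (phi1 X + phi2 X) - u X *: (phi1 Y + phi2 Y).  In
    g (H X Y) Z + g Y (H X Z) the phi2 terms cancel because Phi2 is skew, the
    phi1 terms cancel against the U terms, and only the prescribed f1 and f2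
    terms survive.

    Uniqueness.  If two connections have the same torsion and the same derivative
    of g, then their difference K gives a trilinear expression g (K X Y) Z that
    is symmetric in its first two arguments and skew in its last two.  Such an
    expression is zero ([sym_skew_eq0]), so K = 0 as g is nondegenerate
    ([connection_determined]).  The formula for a given solution then follows
    from its equality with the constructed one.

    Since g is positive definite, a vector field X is determined by the
    functions g X Z ([metric_inj]); hence each identity between vector fields
    becomes a commutative ring identity in C^oo(M) after pairing with Z. *)

Set Implicit Arguments.
Unset Strict Implicit.
Unset Printing Implicit Defensive.

Import Order.TTheory GRing.Theory Num.Theory.
Local Open Scope ring_scope.

(** * Tensor fields as linear maps over the smooth functions *)

Section SmoothLinear.
Variables (R : realType) (n : nat) (M : manifold R n).
Implicit Types (g : riemannian_metric M) (X Y Z : vfield M) (f : Cinf M).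

Lemma form1_ev_scalar (w : form1 M) : scalar w.
Proof. by move=> f X X'; apply/CinfP => p; exact: linearP. Qed.

HB.instance Definition _ (w : form1 M) :=
  GRing.isLinear.Build (Cinf M) (vfield M) (Cinf M) *%R w (form1_ev_scalar w).

Lemma tensor11_ev_linear (w : tensor11 M) : linear w.
Proof. by move=> f X X'; apply/vfieldP => p; exact: linearP. Qed.

HB.instance Definition _ (w : tensor11 M) :=
  GRing.isLinear.Build (Cinf M) (vfield M) (vfield M) *:%R w
    (tensor11_ev_linear w).

Lemma tensor02_ev_scalar (w : tensor02 M) X : scalar (w X).
Proof. by move=> f Y Y'; apply/CinfP => p; exact: linearPr. Qed.

HB.instance Definition _ (w : tensor02 M) X :=
  GRing.isLinear.Build (Cinf M) (vfield M) (Cinf M) *%R (w X)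
    (tensor02_ev_scalar w X).

(** * The metric on vector fields *)

Lemma metricC g X Y : g X Y = g Y X.
Proof. by apply/CinfP => p; exact: (Defs.metric_sym g). Qed.

Lemma metricDr g Z X X' : g Z (X + X') = g Z X + g Z X'.
Proof. exact: linearD. Qed.

Lemma metricDl g X X' Z : g (X + X') Z = g X Z + g X' Z.
Proof. by rewrite !(metricC _ _ Z) metricDr. Qed.

Lemma metricNl g X Z : g (- X) Z = - g X Z.
Proof. by rewrite !(metricC _ _ Z) linearN. Qed.

Lemma metricBl g X X' Z : g (X - X') Z = g X Z - g X' Z.
Proof. by rewrite metricDl metricNl. Qed.

Lemma metricZl g f X Z : g (f *: X) Z = f * g X Z.
Proof. by rewrite !(metricC _ _ Z) linearZ. Qed.

Lemma metric_eq0 g X : g X X = 0 -> X = 0.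
Proof.
move=> /CinfP gX; apply/vfieldP => p; apply/eqP; apply: contraT => Xp.
have gXp : tensor02_at g p (X p) (X p) = 0 := gX p.
by have := Defs.metric_pos g Xp; rewrite gXp ltxx.
Qed.

Lemma metric_inj g X X' : (forall Z, g X Z = g X' Z) -> X = X'.
Proof.
by move=> e; apply/eqP; rewrite -subr_eq0 (@metric_eq0 g (X - X'))//
  metricBl e subrr.
Qed.

(** * Uniqueness: a connection is determined by its torsion and nonmetricity *)

Lemma connection_ext (D D' : connection M) :
  (forall X Y, D X Y = D' X Y) -> D = D'.
Proof.
case: D D' => [D l a b] [D' l' a' b'] /= e.
have {e} eD : D = D' by apply/funext => X; apply/funext => Y.
by move: l a b; rewrite eD => l a b; congr MkConnection;
  exact: Prop_irrelevance.
Qed.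

(** The braid argument behind the Koszul formula: the transpositions (1 2) and
    (2 3) satisfy (2 3)(1 2)(2 3) = (1 2)(2 3)(1 2), but the left side acts on
    [a] by the sign of two skew steps and the right side by that of one; so
    [a = - a], and the smooth functions have no 2-torsion. *)
Lemma sym_skew_eq0 (V : Type) (a : V -> V -> V -> Cinf M) :
  (forall x y z, a x y z = a y x z) -> (forall x y z, a x y z = - a x z y) ->
  forall x y z, a x y z = 0.
Proof.
move=> sym skew x y z.
have aN : a x y z = - a x y z.
  by rewrite {1}skew sym skew opprK sym skew sym.
apply/CinfP => p; have /CinfP /(_ p) aNp := aN.
by apply/eqP; rewrite -eqNr; apply/eqP; rewrite [RHS]aNp.
Qed.

(** The difference K of the two connections makes g (K X Y) Z symmetric in X, Y
    by the equality of torsions, and skew in Y, Z by the equality of the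
    derivatives of g and the symmetry of g. *)
Lemma connection_determined g (D D' : connection M) :
  (forall X Y, torsion D X Y = torsion D' X Y) ->
  (forall X Y Z, nabla_metric D g X Y Z = nabla_metric D' g X Y Z) ->
  D = D'.
Proof.
move=> eT eN; apply: connection_ext => X Y; apply: (@metric_inj g) => Z.
apply/eqP; rewrite -subr_eq0 -metricBl; apply/eqP; move: X Y Z.
apply: sym_skew_eq0 => X Y Z.
- congr (g _ Z); have /addIr e := eT X Y.
  apply/eqP; rewrite subr_eq addrAC -addrA -subr_eq.
  by rewrite -[D' X Y - D' Y X]e; apply/eqP; rewrite opprB addrC subrK.
- have /eqP := eN X Y Z; rewrite -subr_eq0 /nabla_metric => /eqP e.
  rewrite !metricBl -!(metricC g Y); apply/eqP; rewrite -subr_eq0; apply/eqP.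
  by rewrite -[RHS]oppr0 -[in RHS]e; ring.
Qed.

(** * Shifting a connection by a bilinear map *)

Definition shift_connection (D : connection M)
    (H : vfield M -> vfield M -> vfield M)
    (Hl : forall Y, linear (H^~ Y)) (Hr : forall X, linear (H X)) :
  connection M.
Proof.
apply: (@MkConnection R n M (fun X Y => D X Y + H X Y)).
- by move=> f X X' Y; rewrite nabla_linearl Hl scalerDr addrACA.
- move=> X Y Y'; have := Hr X 1 Y Y'; rewrite !scale1r => ->.
  by rewrite nabla_additiver addrACA.
- move=> X f Y; have HZ : H X (f *: Y) = f *: H X Y.
    have H0 : H X 0 = 0.
      by have := Hr X (-1) 0 0; rewrite scaler0 addr0 scaleN1r addNr.
    by have := Hr X f Y 0; rewrite !addr0 H0 addr0.
  by rewrite nabla_leibniz HZ scalerDr addrAC.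
Defined.

Lemma torsion_shift D H Hl Hr X Y :
  torsion (@shift_connection D H Hl Hr) X Y
  = torsion D X Y + (H X Y - H Y X).
Proof. by rewrite /torsion /= opprD [D X Y + _ + _]addrACA [LHS]addrAC. Qed.

Lemma nabla_metric_shift D H Hl Hr g X Y Z :
  nabla_metric (@shift_connection D H Hl Hr) g X Y Z
  = nabla_metric D g X Y Z - (g (H X Y) Z + g Y (H X Z)).
Proof. by rewrite /nabla_metric /= metricDl metricDr; ring. Qed.

(** * The deformation of the Levi-Civita connection *)

Section Deformation.
Variables (g : riemannian_metric M) (f1 f2 : Cinf M) (u u1 : form1 M).
Variables (U U1 U2 : vfield M) (phi1 phi2 : tensor11 M).

Definition deformation X Y : vfield M :=
  u Y *: phi1 X - u X *: phi2 Y - g (phi1 X) Y *: U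
  - f1 *: (u1 X *: Y + u1 Y *: X - g X Y *: U1) - (f2 * g X Y) *: U2.

(** With [metric_inj], this turns bilinearity and the two prescribed conditions
    into ring identities. *)
Lemma metric_deformation X Y Z :
  g (deformation X Y) Z =
  u Y * g (phi1 X) Z - u X * g (phi2 Y) Z - g (phi1 X) Y * g U Z
  - f1 * (u1 X * g Y Z + u1 Y * g X Z - g X Y * g U1 Z)
  - f2 * g X Y * g U2 Z.
Proof. by rewrite /deformation !(metricDl, metricNl, metricZl). Qed.

Lemma deformation_linearl Y : linear (deformation^~ Y).
Proof.
move=> f X X'; apply: (@metric_inj g) => Z.
by rewrite !(metricDl, metricZl, metric_deformation, linearP) /=; ring.
Qed.

Lemma deformation_linearr X : linear (deformation X).
Proof.
move=> f Y Y'; apply: (@metric_inj g) => Z.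
by rewrite !(metricDl, metricZl, metric_deformation, linearP) /=; ring.
Qed.


End Deformation.
End SmoothLinear.

Theorem theorem2p1 (R : realType) (n : nat) (M : manifold R n)
    (g : riemannian_metric M) (D : connection M) (hD : levi_civita g D)
    (f1 f2 : Cinf M) (u u1 u2 : form1 M) (phi : tensor11 M)
    (U U1 U2 : vfield M)
    (hU : forall X : vfield M, u X = g U X)
    (hU1 : forall X : vfield M, u1 X = g U1 X)
    (hU2 : forall X : vfield M, u2 X = g U2 X)
    (Phi Phi1 Phi2 : tensor02 M)
    (hPhi : forall X Y : vfield M, Phi X Y = g (phi X) Y)
    (hPhiD : forall X Y : vfield M, Phi X Y = Phi1 X Y + Phi2 X Y)
    (hPhi1 : forall X Y : vfield M, Phi1 X Y = Phi1 Y X)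
    (hPhi2 : forall X Y : vfield M, Phi2 X Y = - Phi2 Y X)
    (phi1 phi2 : tensor11 M)
    (hphi1 : forall X Y : vfield M, Phi1 X Y = g (phi1 X) Y)
    (hphi2 : forall X Y : vfield M, Phi2 X Y = g (phi2 X) Y) :
  let P (Dt : connection M) : Prop :=
    (forall X Y : vfield M, torsion Dt X Y = u Y *: phi X - u X *: phi Y) /\
    (forall X Y Z : vfield M,
       nabla_metric Dt g X Y Z
       = 2%:R * f1 * u1 X * g Y Z + f2 * (u2 Y * g X Z + u2 Z * g X Y)) in
  (exists! Dt : connection M, P Dt) /\
  (forall Dt : connection M, P Dt -> forall X Y : vfield M,
     Dt X Y = D X Y + u Y *: phi1 X - u X *: phi2 Y - g (phi1 X) Y *: U
              - f1 *: (u1 X *: Y + u1 Y *: X - g X Y *: U1)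
              - (f2 * g X Y) *: U2).
Proof.
move=> P; have [torD metD] := hD.
have gH X Y Z : g (deformation g f1 f2 u u1 U U1 U2 phi1 phi2 X Y) Z =
    u Y * Phi1 X Z - u X * Phi2 Y Z - Phi1 X Y * u Z
    - f1 * (u1 X * g Y Z + u1 Y * g X Z - g X Y * u1 Z) - f2 * g X Y * u2 Z.
  by rewrite metric_deformation -!hphi1 -!hphi2 -hU -hU1 -hU2.
pose Dt := shift_connection D
  (deformation_linearl g f1 f2 u u1 U U1 U2 phi1 phi2)
  (deformation_linearr g f1 f2 u u1 U U1 U2 phi1 phi2).
have PDt : P Dt.
  split=> [X Y|X Y Z].
    rewrite torsion_shift torD add0r; apply: (metric_inj (g := g)) => Z.
    rewrite [LHS]metricBl !gH metricBl !metricZl -!hPhi !hPhiD.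
    (* Normalising the symmetric factors to one order lets ring cancel the
       terms along U, U1 and U2. *)
    by rewrite (hPhi1 Y X) (metricC g Y X); ring.
  rewrite nabla_metric_shift metD (metricC g Y) !gH.
  by rewrite (hPhi2 Z Y) (metricC g Z Y); ring.
have unique Dt' : P Dt' -> Dt = Dt'.
  move=> [tor' met']; have [tor met] := PDt.
  by apply: (@connection_determined _ _ _ g) => [X Y|X Y Z];
    rewrite ?tor ?tor' ?met ?met'.
split; first by exists Dt; split.
by move=> Dt' /unique <- X Y; rewrite /= /deformation !addrA.
Qed.
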